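(* For any element $w\in W$ (where $W$ is the Coxeter group of type $\tilde A_2$) and any reduced word $s_{i_1}\cdots s_{i_k}$ representing $w$, the Words-to-Coordinates Algorithm applied to this word outputs the coordinates $(n,m)$ of the alcove corresponding to $w$; that is, its output $(n,m)$ has $n$ even and satisfies $a(n,m)=w$.
   Context: $W=\langle s_0,s_1,s_2\mid s_i^2=1,(s_0s_1)^3=(s_0s_2)^3=(s_1s_2)^3=1\rangle$ is the Coxeter group of type $\tilde A_2$, with length function $\ell$. Subscripts of generators are read modulo 3. For $k\ge 0$, $\gamma_i(k)=s_is_{i+1}s_{i+2}\cdots$ is the word with $k$ letters whose subscripts increase by one (mod 3) at each step (an increasing word), and $\delta_i(k)=s_is_{i-1}s_{i-2}\cdots$ is the word with $k$ letters whose subscripts decrease by one (mod 3) at each step (a decreasing word). Words of length one are both increasing and decreasing. Put $\epsilon_k=1$ if $k$ is odd and $\epsilon_k=0$ if $k$ is even. Coordinates: elements of $W$ correspond bijectively to alcoves of the Coxeter complex. For $(n,m)\in\mathbb Z^2$ let $a(n,m)=b(n)\,c(n,m)\in W$, where $b(n)=\gamma_0(n)$ if $n\ge 0$, $b(n)=\delta_2(-n)$ if $n<0$, and $c(n,m)=\delta_{n+1}(m)$ if $m\ge 0$, $c(n,m)=\gamma_{n+2}(-m)$ if $m<0$. The (even) coordinates of $w\in W$ are the pair $(n,m)$ with $n$ even and $a(n,m)=w$. Words-to-Coordinates Algorithm. Input: a reduced word $w$. The empty word gets $(0,0)$. Otherwise let $s_i$ be its first letter and write $w=w_1w_2$ with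 $w_1$ the longest decreasing prefix. - If $\ell(w_1)$ is even and $\ell(w_2)>0$: set $j\equiv i-1\pmod 3$, and decompose $w$ from the left into consecutive blocks $w=\delta_{i_1}(n_1)\gamma_{i_2}(n_2)\delta_{i_3}(n_3)\gamma_{i_4}(n_4)\cdots$, alternately decreasing and increasing, beginning with a decreasing block, each block taken of maximal length, all $n_k>0$. Let $u=\sum_{k\text{ even}}n_k$ (the number of letters in increasing blocks). - Otherwise: set $j=i$, and decompose $w$ from the left into consecutive blocks $w=\gamma_{i_1}(n_1)\delta_{i_2}(n_2)\gamma_{i_3}(n_3)\delta_{i_4}(n_4)\cdots$, alternately increasing and decreasing, beginning with an increasing block (even if it has length one), each block of maximal length, all $n_k>0$. Let $u=\sum_{k\text{ odd}}n_k$ (the number of letters in increasing blocks). If the last block is an increasing block of odd length, set $x=u+1$, $y=\ell(w)-u-1$; otherwise set $x=u$, $y=\ell(w)-u$. The output is $$(n,m)=\begin{cases}(x,y)& j=0,\ x\text{ even},\\ (x+y+1-\epsilon_y,\,-y-1)& j=0,\ x\text{ odd},\\ (-x-y+\epsilon_y,\,x-\epsilon_y)& j=1,\ x\text{ even},\\ (1-x,\,x+y)& j=1,\ x\text{ odd},\\ (y+\epsilon_y,\,-x-y)& j=2,\ x\text{ even},\\ (-y-\epsilon_y,\,-x+\epsilon_y)& j=2,\ x\text{ odd}.\end{cases}$$ *)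

(* Defs.v *)
From HB Require Import structures.
From mathcomp Require Import all_boot all_order all_algebra.
From mathcomp Require Import generic_quotient.
From mathcomp Require Import boolp.

Set Implicit Arguments.
Unset Strict Implicit.
Unset Printing Implicit Defensive.

Import Order.TTheory GRing.Theory Num.Theory.

(* Words in the generators s_0, s_1, s_2; subscripts live in the ring Z/3. *)
Definition word := seq 'Z_3.

(* Because s_i ^ 2 = 1 is among the relations, every element of W is the class *)
(* of a positive word, and the monoid presented by these relations is the      *)
(* group W.  Lemmas gen_relations, W_generated and W_universal below check     *)
(* that W is the group with this presentation.                                 *)
Definition relators : seq word :=
  [:: [:: 0%R; 0%R]; [:: 1%R; 1%R]; [:: 2%R; 2%R];
      [:: 0%R; 1%R; 0%R; 1%R; 0%R; 1%R];
      [:: 0%R; 2%R; 0%R; 2%R; 0%R; 2%R];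
      [:: 1%R; 2%R; 1%R; 2%R; 1%R; 2%R]].

Inductive word_equiv : word -> word -> Prop :=
| we_relator (u r v : word) : r \in relators -> word_equiv (u ++ r ++ v) (u ++ v)
| we_refl u : word_equiv u u
| we_sym u v : word_equiv u v -> word_equiv v u
| we_trans u v t : word_equiv u v -> word_equiv v t -> word_equiv u t.

Definition word_equivb : rel word := fun u v => `[< word_equiv u v >].

Lemma word_equivb_refl : reflexive word_equivb.
Proof. by move=> u; apply/asboolP; apply: we_refl. Qed.

Lemma word_equivb_sym : symmetric word_equivb.
Proof. by move=> u v; apply/asboolP/asboolP; apply: we_sym. Qed.

Lemma word_equivb_trans : transitive word_equivb.
Proof.
by move=> v u t /asboolP uv /asboolP vt; apply/asboolP; apply: we_trans uv vt.
Qed.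

Canonical word_equivb_equiv :=
  EquivRel word_equivb word_equivb_refl word_equivb_sym word_equivb_trans.

Definition W := {eq_quot word_equivb}%qT.
HB.instance Definition _ := Choice.on W.

Definition elt (w : word) : W := (\pi_W w)%qT.

Lemma eltP (u v : word) : elt u = elt v <-> word_equiv u v.
Proof. by split=> [/eqmodP/asboolP //| uv]; apply/eqmodP/asboolP. Qed.

Lemma elt_repr (g : W) : elt (repr g) = g.
Proof. exact: reprK. Qed.

Lemma we_catl (t u v : word) : word_equiv u v -> word_equiv (t ++ u) (t ++ v).
Proof.
elim=> {u v} [u r v hr|u|u v _ h|u v s _ h1 _ h2].
- by rewrite !catA -(catA (t ++ u)); apply: we_relator.
- exact: we_refl.
- exact: we_sym.
- exact: we_trans h1 h2.
Qed.

Lemma we_catr (t u v : word) : word_equiv u v -> word_equiv (u ++ t) (v ++ t).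
Proof.
elim=> {u v} [u r v hr|u|u v _ h|u v s _ h1 _ h2].
- by rewrite -!catA; apply: we_relator.
- exact: we_refl.
- exact: we_sym.
- exact: we_trans h1 h2.
Qed.

Lemma we_letter2 (i : 'Z_3) : word_equiv [:: i; i] [::].
Proof.
apply: (@we_relator [::] [:: i; i] [::]).
by case: i => [[|[|[|i]]] hi].
Qed.

Lemma we_rev_cat (u : word) : word_equiv (rev u ++ u) [::].
Proof.
elim: u => [|i u IHu]; first exact: we_refl.
rewrite rev_cons cat_rcons; apply: we_trans IHu; apply: we_catl.
exact: we_catr (we_letter2 i).
Qed.

Definition W_mul (g h : W) : W := elt (repr g ++ repr h).
Definition W_inv (g : W) : W := elt (rev (repr g)).

Lemma elt_cat (u v : word) : elt (u ++ v) = W_mul (elt u) (elt v).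
Proof.
apply/eltP/(@we_trans _ (repr (elt u) ++ v)).
  by apply: we_catr; apply/eltP; rewrite elt_repr.
by apply: we_catl; apply/eltP; rewrite elt_repr.
Qed.

Lemma W_mulA : associative W_mul.
Proof.
move=> g h k; rewrite -(elt_repr g) -(elt_repr h) -(elt_repr k).
by rewrite -!elt_cat catA.
Qed.

Lemma W_mul1g : left_id (elt [::]) W_mul.
Proof. by move=> g; rewrite -(elt_repr g) -elt_cat. Qed.

Lemma W_mulg1 : right_id (elt [::]) W_mul.
Proof. by move=> g; rewrite -(elt_repr g) -elt_cat cats0. Qed.

Lemma W_mulVg : left_inverse (elt [::]) W_inv W_mul.
Proof.
move=> g; rewrite /W_inv -[X in W_mul _ X](elt_repr g) -elt_cat.
by apply/eltP; apply: we_rev_cat.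
Qed.

Lemma W_mulgV : right_inverse (elt [::]) W_inv W_mul.
Proof.
move=> g; rewrite /W_inv -[X in W_mul X _](elt_repr g) -elt_cat.
by apply/eltP; rewrite -[X in X ++ _]revK; apply: we_rev_cat.
Qed.

HB.instance Definition _ :=
  isGroup.Build W W_mulA W_mul1g W_mulg1 W_mulVg W_mulgV.

Definition gen (i : 'Z_3) : W := elt [:: i].

Lemma eltE (w : word) : elt w = (\prod_(i <- w) gen i)%g.
Proof.
elim: w => [|i w IHw]; first by rewrite big_nil.
by rewrite big_cons -IHw; apply: (elt_cat [:: i]).
Qed.

Lemma gen_relations (r : word) :
  r \in relators -> (\prod_(i <- r) gen i = 1)%g.
Proof.
by move=> hr; rewrite -eltE; apply/eltP; have := we_relator [::] [::] hr;
  rewrite cats0.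
Qed.

Lemma W_generated (g : W) : exists w : word, g = (\prod_(i <- w) gen i)%g.
Proof. by exists (repr g); rewrite -eltE elt_repr. Qed.

Lemma W_universal (G : groupType) (f : 'Z_3 -> G) :
    (forall r, r \in relators -> \prod_(i <- r) f i = 1)%g ->
  exists F : W -> G,
    [/\ {morph F : g h / (g * h)%g}, F 1%g = 1%g & forall i, F (gen i) = f i].
Proof.
move=> hf; have F_we u v : word_equiv u v ->
    (\prod_(i <- u) f i = \prod_(i <- v) f i)%g.
  elim=> {u v} [u r v hr|//|u v _ -> //|u v t _ -> _ -> //].
  by rewrite !big_cat /= (hf _ hr) mul1g.
have F_elt u : (\prod_(i <- repr (elt u)) f i = \prod_(i <- u) f i)%g.
  by apply: F_we; apply/eltP; rewrite elt_repr.
exists (fun g : W => \prod_(i <- repr g) f i)%g; split=> [g h||i].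
- by rewrite F_elt big_cat.
- by rewrite F_elt big_nil.
- by rewrite F_elt big_seq1.
Qed.

Lemma W_length_subproof (g : W) :
  exists k, `[< exists2 w : word, elt w = g & size w = k >].
Proof. by exists (size (repr g)); apply/asboolP; exists (repr g); rewrite ?elt_repr. Qed.

(* The length function of (W, {s_0, s_1, s_2}). *)
Definition W_length (g : W) : nat := ex_minn (W_length_subproof g).

Definition reduced (w : word) : Prop := size w = W_length (elt w).

Definition step (increasing : bool) (i : 'Z_3) : 'Z_3 :=
  (if increasing then i + 1 else i - 1)%R.

Definition gamma (i : 'Z_3) (k : nat) : word := traject (step true) i k.
Definition delta (i : 'Z_3) (k : nat) : word := traject (step false) i k.

Definition alcove_b (n : int) : word :=
  if (0 <= n)%R then gamma 0%R `|n|%N else delta 2%R `|n|%N.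

Definition alcove_c (n m : int) : word :=
  if (0 <= m)%R then delta (n%:~R + 1)%R `|m|%N else gamma (n%:~R + 2)%R `|m|%N.

Definition alcove (n m : int) : W := (elt (alcove_b n) * elt (alcove_c n m))%g.

Definition even_coordinates (g : W) (p : int * int) : Prop :=
  ~~ odd `|p.1|%N /\ alcove p.1 p.2 = g.

Definition decreasing (w : word) : bool := sorted (fun i j => j == step false i) w.

Definition longest_decreasing_prefix (w : word) : word :=
  take (\max_(k < (size w).+1 | decreasing (take k w)) k) w.

(* Greedy decomposition of w into maximal blocks that are alternately          *)
(* increasing (tag true) and decreasing (tag false), the first one having tag  *)
(* dir; its defining properties are checked in blocks_cat and blocks_maximal.  *)
Fixpoint blocks (dir : bool) (w : word) : seq (bool * word) :=
  if w isn't i :: w' then [::] else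
  if blocks dir w' is (_, j :: v) :: bs then
    if j == step dir i then (dir, i :: j :: v) :: bs
    else (dir, [:: i]) :: blocks (~~ dir) w'
  else [:: (dir, [:: i])].

Fixpoint maximal_blocks (dir : bool) (bs : seq (bool * word)) : Prop :=
  match bs with
  | [::] => True
  | b :: bs' =>
      [/\ b.1 = dir,
          exists i k, b.2 = traject (step dir) i k.+1,
          (* the first letter of the next block does not extend b *)
          (if bs' is b' :: _ then
             head 0%R b'.2 != step dir (last 0%R b.2) else true)
        & maximal_blocks (~~ dir) bs']
  end.

Lemma blocks_cons (dir : bool) (i : 'Z_3) (w : word) :
  exists v bs, blocks dir (i :: w) = (dir, i :: v) :: bs.
Proof.
rewrite /=; case: (blocks dir w) => [|[d [|j v]] bs]; try by exists [::], [::].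
by case: ifP => _; [exists (j :: v), bs | exists [::], (blocks (~~ dir) w)].
Qed.

Lemma blocks_cat (dir : bool) (w : word) :
  flatten [seq b.2 | b <- blocks dir w] = w.
Proof.
elim: w dir => [//|i [//|j w] IHw] dir.
have := IHw dir; rewrite [blocks dir (i :: _)]/= -/(blocks dir (j :: w)).
have [v [bs ->]] := blocks_cons dir j w.
by case: ifP => _ /= h; rewrite ?h // (IHw (~~ dir)).
Qed.

Lemma blocks_maximal (dir : bool) (w : word) : maximal_blocks dir (blocks dir w).
Proof.
elim: w dir => [//|i [|j w] IHw] dir; first by split=> //; exists i, 0.
have := IHw dir; have := IHw (~~ dir).
rewrite [blocks dir (i :: _)]/= -/(blocks dir (j :: w)).
rewrite -/(blocks (~~ dir) (j :: w)).
have [v [bs ->]] := blocks_cons dir j w.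
have [v' [bs' ->]] := blocks_cons (~~ dir) j w.
move=> h' [_ [j' [k [ej ev]]] hn hbs].
case: eqP => [eji|/eqP nji]; split=> //; last by exists i, 0.
by exists i, k.+1; rewrite /= -eji ev ej.
Qed.

Definition epsilon (k : int) : int := odd `|k|%N.

(* As integers: y can be negative, e.g. y = -1 for a word of length one. *)
Definition words_to_coordinates (w : word) : int * int :=
  if w isn't i :: _ then (0, 0)%R else
  let w1 := longest_decreasing_prefix w in
  let w2 := drop (size w1) w in
  let start_decreasing := ~~ odd (size w1) && (0 < size w2)%N in
  let j : 'Z_3 := if start_decreasing then (i - 1)%R else i in
  let bs := blocks (~~ start_decreasing) w in
  let u := (\sum_(b <- bs | b.1) size b.2)%N in
  let last_block := last (true, [::]) bs in
  let x : int := if last_block.1 && odd (size last_block.2) then u.+1 else u in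
  let y : int := (Posz (size w) - x)%R in
  if j == 0%R then
    if ~~ odd `|x|%N then (x, y)
    else (x + y + 1 - epsilon y, - y - 1)%R
  else if j == 1%R then
    if ~~ odd `|x|%N then (- x - y + epsilon y, x - epsilon y)%R
    else (1 - x, x + y)%R
  else
    if ~~ odd `|x|%N then (y + epsilon y, - x - y)%R
    else (- y - epsilon y, - x + epsilon y)%R.

(* Main.v *)
Require Import Defs.
From mathcomp Require Import all_boot all_order all_algebra.
From mathcomp Require Import boolp zify ring.

(* A word without equal neighbours is a first letter followed by a sequence of *)
(* directions (+1 or -1).  By braid moves, two directions ++ commute with --   *)
(* and a run of odd length strictly inside the sequence can be shortened; so   *)
(* the directions of a reduced word, possibly preceded by a virtual one for    *)
(* the first letter, are grouped in constant pairs, with at most one direction *)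
(* left over at the end.                                                       *)
(* In coordinates, right multiplication by a generator moves the alcove        *)
(* (n, m), n even, to one of its three neighbours (n, m + 1), (n, m - 1) and   *)
(* (n + 2, m - 1) or (n - 2, m + 1), as m is even or odd.  Reading a pair ++   *)
(* then changes (x, y) into (x + 2, y) in the output formula of the algorithm, *)
(* and reading -- changes it into (x, y + 2), so the formula follows along the *)
(* word.                                                                       *)

Set Implicit Arguments.
Unset Strict Implicit.
Unset Printing Implicit Defensive.

Import GRing.Theory Num.Theory.
Local Open Scope ring_scope.
Local Open Scope group_scope.

Arguments gen i%_R.
Arguments step increasing i%_R : simpl never.
Arguments alcove (n m)%_R.
Arguments alcove_b n%_R.
Arguments alcove_c (n m)%_R.

(** A word is traced as a gallery of alcoves starting at the identity, each letter crossing one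
    wall. The output formula [coordinates_of], read as a function of arbitrary integers x and y,
    follows this gallery: [coordinates_of_dec] and [coordinates_of_inc] check single crossings, and
    [alcove_at_steps] iterates them over directions grouped in equal pairs.

    Reduced words have such directions by [geodesic_paired], since an odd run between two opposite
    directions can be shortened. The algorithm detects where the pairs begin: either a virtual
    direction into the first letter is paired with the next one, and x is even
    ([words_to_coordinates_even]), or the pairs begin after the first letter, and x is odd
    ([words_to_coordinates_odd]). *)

Local Notation steps := (scanl (fun i d => step d i)).

(** * Words, letters modulo 3 and braid relations *)

Lemma elt_nil : elt [::] = 1.
Proof. by []. Qed.

Lemma eltM (u v : word) : elt (u ++ v) = elt u * elt v.
Proof. exact: elt_cat. Qed.

Lemma elt_cons i (w : word) : elt (i :: w) = gen i * elt w.
Proof. exact: (eltM [:: i]). Qed.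

Lemma elt_rcons (w : word) i : elt (rcons w i) = elt w * gen i.
Proof. by rewrite -cats1 eltM. Qed.

Lemma genK (i : 'Z_3) : gen i * gen i = 1.
Proof. by rewrite -elt_cons; apply/eltP/we_letter2. Qed.

Lemma Z3_cases (i : 'Z_3) : [\/ i = 0, i = 1 | i = 2]%R.
Proof.
have := valP i; case: i => [[|[|[|//]]] hi] _.
- by constructor 1; apply: val_inj.
- by constructor 2; apply: val_inj.
- by constructor 3; apply: val_inj.
Qed.

Lemma Z3_neq_step (i j : 'Z_3) : j != i -> exists d, j = step d i.
Proof.
by case: (Z3_cases i) => ->; case: (Z3_cases j) => -> //= _;
   solve [exists true; exact: val_inj | exists false; exact: val_inj].
Qed.

Lemma step_eq d e (i : 'Z_3) : (step d i == step e i) = (d == e).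
Proof. by case: (Z3_cases i) => ->; case: d; case: e. Qed.

Lemma stepK d : cancel (step d) (step (~~ d)).
Proof. by move=> i; case: d => /=; rewrite /step; ring. Qed.

Lemma step2 d (i : 'Z_3) : step d (step d i) = step (~~ d) i.
Proof. by case: (Z3_cases i) => ->; case: d; apply: val_inj. Qed.

Lemma gen_braid (d : bool) (i : 'Z_3) :
  gen i * gen (step d i) * gen i = gen (step d i) * gen i * gen (step d i).
Proof.
have braid a b : [:: a; b; a; b; a; b] \in relators ->
    gen a * gen b * gen a = gen b * gen a * gen b.
  move=> /gen_relations; rewrite !big_cons big_nil mulg1 => r.
  apply: (mulIg (gen b * gen a * gen b)).
  have -> : gen b * gen a * gen b * (gen b * gen a * gen b) = 1.
    rewrite -!mulgA (mulgA (gen b) (gen b)) genK mul1g.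
    by rewrite (mulgA (gen a)) genK mul1g genK.
  by rewrite -[RHS]r !mulgA.
by case: (Z3_cases i) => ->; case: d;
  first [exact: braid | symmetry; exact: braid].
Qed.

(** * The three neighbours of an alcove in coordinates *)

Lemma intr_Z3_mod (a b : int) :
  (a = b %[mod 3])%Z -> (a%:~R = b%:~R :> 'Z_3)%R.
Proof.
move=> ab; have -> : a = (b + 3 * ((a %/ 3)%Z - (b %/ 3)%Z))%R by lia.
by rewrite intrD intrM (_ : 3%:~R = 0)%R ?mul0r ?addr0 //; apply: val_inj.
Qed.

Lemma iter_step d k (i : 'Z_3) :
  iter k (step d) i = (if d then i + k%:R else i - k%:R)%R.
Proof.
elim: k => [|k IHk]; first by rewrite subr0 addr0; case: d.
by rewrite iterS IHk /step -natr1; case: (d); ring.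
Qed.

Lemma elt_trajectS d i k :
  elt (traject (step d) i k.+1) =
  elt (traject (step d) i k) * gen (iter k (step d) i).
Proof. by rewrite trajectSr elt_rcons. Qed.

(** For negative [n] the generator is the last letter of [alcove_b n] and cancels it; [alcove_cS]
    works in the same way. *)
Lemma alcove_bS (n : int) :
  elt (alcove_b n) * gen n%:~R = elt (alcove_b (n + 1)).
Proof.
rewrite /alcove_b /gamma /delta; case: n => [k|k].
  have -> : (Posz k + 1)%R = k.+1 by lia.
  by rewrite /= elt_trajectS iter_step add0r.
rewrite /= elt_trajectS iter_step -mulgA NegzE.
have -> : ((- Posz k.+1)%:~R = 2 - k%:R :> 'Z_3)%R.
  rewrite (@intr_Z3_mod _ (2 - Posz k)%R); last by lia.
  by rewrite intrB.
by rewrite genK mulg1; case: k => [|k] //=; rewrite subn1.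
Qed.

Lemma alcove_cS (n m : int) :
  elt (alcove_c n m) * gen (n + 1 - m)%:~R = elt (alcove_c n (m + 1)).
Proof.
rewrite /alcove_c /gamma /delta; case: m => [k|k].
  have -> : (Posz k + 1)%R = k.+1 by lia.
  by rewrite /= elt_trajectS iter_step !intrB intrD.
rewrite /= elt_trajectS iter_step -mulgA NegzE.
have -> : ((n + 1 - - Posz k.+1)%:~R = n%:~R + 2 + k%:R :> 'Z_3)%R.
  rewrite (@intr_Z3_mod _ (n + 2 + Posz k)%R); last by lia.
  by rewrite !intrD.
by rewrite genK mulg1; case: k => [|k] //=; rewrite subn1.
Qed.

Lemma alcove_up (n m z : int) : ((z = n + 1 - m %[mod 3])%Z)%R ->
  alcove n m * gen z%:~R = alcove n (m + 1).
Proof. by move=> /intr_Z3_mod ->; rewrite /alcove -mulgA alcove_cS. Qed.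

Lemma alcove_down (n m z : int) : ((z = n + 2 - m %[mod 3])%Z)%R ->
  alcove n m * gen z%:~R = alcove n (m - 1).
Proof.
move=> zE; apply: (mulIg (gen z%:~R)); rewrite -mulgA genK mulg1.
by rewrite alcove_up ?subrK //; lia.
Qed.

Lemma gen_braid_intr (z : int) :
  gen (z + 1)%:~R * gen z%:~R * gen (z + 1)%:~R =
  gen z%:~R * gen (z + 1)%:~R * gen z%:~R.
Proof. by rewrite intrD -(gen_braid true). Qed.

(* The third wall of the alcove (n, m), for m = 2k: the braid relation in      *)
(* a(n, m) s_(n+1-m) s_(n-m) s_(n+1-m) carries the claim from m to m + 2.      *)
Lemma alcove_cross (n k : int) :
  alcove n (2 * k) * gen (n - 2 * k)%:~R = alcove (n + 2) (2 * k - 1).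
Proof.
pose crosses j :=
  alcove n (2 * j) * gen (n - 2 * j)%:~R = alcove (n + 2) (2 * j - 1).
rewrite -/(crosses k).
have up2 j : crosses j <-> crosses (j + 1)%R.
  rewrite /crosses; have -> : alcove n (2 * (j + 1)) =
      alcove n (2 * j) * gen (n - 2 * j + 1)%:~R * gen (n - 2 * j)%:~R.
    by rewrite alcove_up ?alcove_up; [congr alcove; ring | lia..].
  rewrite (@intr_Z3_mod (n - 2 * (j + 1))%R (n - 2 * j + 1)%R); last by lia.
  have -> : alcove (n + 2) (2 * (j + 1) - 1) =
      alcove (n + 2) (2 * j - 1) *
      gen (n - 2 * j + 1)%:~R * gen (n - 2 * j)%:~R.
    by rewrite alcove_up ?alcove_up; [congr alcove; ring | lia..].
  rewrite -!mulgA (mulgA (gen _) (gen _)) gen_braid_intr !mulgA.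
  by split=> [-> // | /mulIg /mulIg].
(* For m = 0 both sides are b(n + 1), as b(n + 2) ends one crossing of s_(n+1) further. *)
have base : crosses 0%R.
  have row n' : alcove n' 0 = elt (alcove_b n') by exact: mulg1.
  rewrite /crosses mulr0 subr0 -(@alcove_down _ _ (n + 1)%R); last by lia.
  rewrite !row (_ : n + 2 = n + 1 + 1)%R; last by ring.
  by rewrite -!alcove_bS -mulgA genK mulg1.
elim/int_ind: k => [|k /up2|k IH] //.
  by have -> : (Posz k + 1 = k.+1)%R by lia.
apply/up2; suff -> : (- Posz k.+1 + 1 = - Posz k)%R by [].
by lia.
Qed.

Lemma alcove_third_even (n m z : int) :
  ~~ odd `|m|%N -> ((z = n - m %[mod 3])%Z)%R ->
  alcove n m * gen z%:~R = alcove (n + 2) (m - 1).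
Proof.
move=> mE /intr_Z3_mod ->; have -> : m = (2 * (m %/ 2)%Z)%R by lia.
exact: alcove_cross.
Qed.

Lemma alcove_third_odd (n m z : int) :
  odd `|m|%N -> ((z = n - m %[mod 3])%Z)%R ->
  alcove n m * gen z%:~R = alcove (n - 2) (m + 1).
Proof.
move=> mE zE; apply: (mulIg (gen z%:~R)); rewrite -mulgA genK mulg1.
by rewrite alcove_third_even ?subrK ?addrK //; lia.
Qed.

(** * Crossing a wall in the output formula *)

Definition coordinates_of (j : 'Z_3) (x y : int) : int * int :=
  (if j == 0 then
    if ~~ odd `|x|%N then (x, y)
    else (x + y + 1 - epsilon y, - y - 1)
  else if j == 1 then
    if ~~ odd `|x|%N then (- x - y + epsilon y, x - epsilon y)
    else (1 - x, x + y)
  else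
    if ~~ odd `|x|%N then (y + epsilon y, - x - y)
    else (- y - epsilon y, - x + epsilon y))%R.

Arguments coordinates_of (j x y)%_R.

Lemma coordinates_of_even j x y : ~~ odd `|(coordinates_of j x y).1|%N.
Proof.
rewrite /coordinates_of /epsilon.
by case: ifP => _; [|case: ifP => _]; case: ifP => h /=; lia.
Qed.

Definition alcove_at (p : int * int) : W := alcove p.1 p.2.

Ltac neighbour :=
  first [ rewrite alcove_up; [by congr alcove; lia | lia]
        | rewrite alcove_down; [by congr alcove; lia | lia]
        | rewrite alcove_third_even; [by congr alcove; lia | lia | lia]
        | rewrite alcove_third_odd; [by congr alcove; lia | lia | lia] ].

Lemma odd_abszD (x y : int) : odd `|(x + y)%R|%N = odd `|x|%N (+) odd `|y|%N.
Proof. lia. Qed.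

(** Once j and the parities of x and y are fixed, the formula is linear and both sides are
    neighbouring alcoves. *)
Lemma coordinates_of_dec j x y :
  alcove_at (coordinates_of j x y) * gen (j - 2 + x%:~R - y%:~R)%R =
  alcove_at (coordinates_of j x (y + 1)).
Proof.
(* The letter is lifted to an integer, so that the side conditions become congruences modulo 3. *)
have -> : (j - 2 + x%:~R - y%:~R = (Posz j - 2 + x - y)%:~R :> 'Z_3)%R.
  by rewrite !intrD !intrN -[X in (X - _ + _ - _)%R]natr_Zp.
rewrite /alcove_at /coordinates_of /epsilon odd_abszD.
case hx: (odd `|x|%N); case hy: (odd `|y|%N); case: j => [[|[|[|//]]] hj] /=.
all: neighbour.
Qed.

(** This is the first half of a pair ++; a crossing of [coordinates_of_dec] then completes it to (x
    + 2, y). *)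
Lemma coordinates_of_inc j x y : ~~ odd `|y|%N ->
  alcove_at (coordinates_of j x y) * gen (j + x%:~R - y%:~R)%R =
  alcove_at (coordinates_of j (x + 2) (y - 1)).
Proof.
have -> : (j + x%:~R - y%:~R = (Posz j + x - y)%:~R :> 'Z_3)%R.
  by rewrite !intrD !intrN -[X in (X + _ - _)%R]natr_Zp.
move=> /negbTE yE; rewrite /alcove_at /coordinates_of /epsilon.
rewrite !odd_abszD abszN yE.
case xE: (odd `|x|%N); case: j => [[|[|[|//]]] hj] /=.
all: neighbour.
Qed.

(** * Following the formula along paired directions *)

Fixpoint paired (E : seq bool) : bool :=
  if E is a :: b :: E' then (a == b) && paired E' else true.

Lemma paired_ind (P : seq bool -> Prop) :
  P [::] -> (forall d, P [:: d]) ->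
  (forall d E, paired E -> P E -> P (d :: d :: E)) ->
  forall E, paired E -> P E.
Proof.
move=> P0 P1 P2 E; have [n] := ubnP (size E); elim: n E => // n IHn.
move=> [|a [|b E]] //= ltEn /andP[/eqP <- pE]; apply: P2 => //.
by apply: IHn => //; lia.
Qed.

Lemma paired_nseq d n : paired (nseq n d).
Proof.
have [m] := ubnP n; elim: m n => // m IHm [|[|n]] //= ltnm.
by rewrite eqxx IHm //; lia.
Qed.

(* When the direction left over by the pairing is increasing, x = u + 1.       *)
Definition dangling (E : seq bool) : bool := odd (size E) && last false E.

Lemma alcove_at_steps E : paired E -> forall j (x y : int), ~~ odd `|y|%N ->
  let x' := (x + count id E + dangling E)%R in
  alcove_at (coordinates_of j x y) * elt (steps (j - 1 + x%:~R - y%:~R)%R E) =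
  alcove_at (coordinates_of j x' (x + y + size E - x')).
Proof.
elim/paired_ind => {E} [|d|d E _ IHE] j x y yE /=.
- by rewrite elt_nil mulg1; congr (alcove_at (coordinates_of _ _ _)); lia.
- rewrite /dangling elt_cons elt_nil mulg1 /=; case: d; rewrite /step /=.
    have -> : (j - 1 + x%:~R - y%:~R + 1 = j + x%:~R - y%:~R)%R by ring.
    by rewrite coordinates_of_inc //;
      congr (alcove_at (coordinates_of _ _ _)); lia.
  have -> : (j - 1 + x%:~R - y%:~R - 1 = j - 2 + x%:~R - y%:~R)%R by ring.
  by rewrite coordinates_of_dec //;
    congr (alcove_at (coordinates_of _ _ _)); lia.
have -> : dangling [:: d, d & E] = dangling E.
  by rewrite /dangling /= negbK; case: E {IHE} => //=; rewrite andbF.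
rewrite !elt_cons !mulgA; case: d; rewrite /step /=.
  have -> : (j - 1 + x%:~R - y%:~R + 1 = j + x%:~R - y%:~R)%R by ring.
  (* The pair ++ passes through (x + 2, y - 1) and ends at (x + 2, y). *)
  rewrite coordinates_of_inc //.
  have -> : (j + x%:~R - y%:~R + 1 = j - 2 + (x + 2)%:~R - (y - 1)%:~R)%R.
    by rewrite !intrD intrN; ring.
  rewrite coordinates_of_dec subrK.
  have -> : (j - 2 + (x + 2)%:~R - (y - 1)%:~R = j - 1 + (x + 2)%:~R - y%:~R)%R.
    by rewrite !intrD intrN; ring.
  by rewrite IHE //; congr (alcove_at (coordinates_of _ _ _)); lia.
have -> : (j - 1 + x%:~R - y%:~R - 1 = j - 2 + x%:~R - y%:~R)%R by ring.
rewrite coordinates_of_dec.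
have -> : (j - 2 + x%:~R - y%:~R - 1 = j - 2 + x%:~R - (y + 1)%:~R)%R.
  by rewrite intrD; ring.
rewrite coordinates_of_dec.
have -> : (j - 2 + x%:~R - (y + 1)%:~R = j - 1 + x%:~R - (y + 1 + 1)%:~R)%R.
  by rewrite !intrD; ring.
rewrite IHE; last by lia.
by congr (alcove_at (coordinates_of _ _ _)); lia.
Qed.

(* The state is the tag of the last block with the parity of its length.       *)
Definition block_step (s : bool * bool) (e : bool) : bool * bool :=
  (e, (s.1 != e) || ~~ s.2).

(** * The algorithm expressed in directions *)

Lemma blocks_stepE d e i w :
  blocks d [:: i, step e i & w] =
    if e == d then
      let bs := blocks d (step e i :: w) in
      (d, i :: (head (d, [::]) bs).2) :: behead bs
    else (d, [:: i]) :: blocks e (step e i :: w).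
Proof.
rewrite [LHS]/= -/(blocks d (step e i :: w)) -/(blocks (~~ d) (step e i :: w)).
have [v [bs ->]] := blocks_cons d (step e i) w.
by rewrite step_eq; case: eqVneq => // ed; case: d e ed => [] [].
Qed.

(** Each letter after the first lies in a block tagged by the direction leading to it; the first one
    takes the tag [d]. *)
Lemma count_blocks d i E :
  (\sum_(b <- blocks d (i :: steps i E) | b.1) size b.2 = d + count id E)%N.
Proof.
elim: E d i => [|e E IHE] d i; first by rewrite big_cons big_nil; case: d.
rewrite [steps _ _]/= blocks_stepE; case: eqVneq => [-> | ed].
  have := IHE d (step d i).
  have [v [bs ->]] := blocks_cons d (step d i) (steps (step d i) E).
  by rewrite !big_cons /=; case: (d) => /= h; lia.
by rewrite big_cons /= IHE; case: d e ed => [] [] //= _; lia.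
Qed.

Lemma last_blocks d i E :
  let b := last (true, [::]) (blocks d (i :: steps i E)) in
  (b.1, odd (size b.2)) = foldl block_step (d, true) E.
Proof.
(* The induction needs an arbitrary initial parity [p]; it affects the result only while the first
   block is also the last. *)
suff main p : let bs := blocks d (i :: steps i E) in
    let b := last (true, [::]) bs in
    (b.1, odd (size b.2) (+) (~~ p && (size bs == 1)%N)) =
    foldl block_step (d, p) E.
  by rewrite /= -(main true) addbF.
elim: E d i p => [|e E IHE] d i p /=; first by rewrite andbT negbK.
rewrite -/(blocks d (i :: step e i :: steps (step e i) E)).
rewrite blocks_stepE; case: eqVneq => [-> | ed].
  have := IHE d (step d i) (~~ p).
  have [v [[|b bs] ->]] := blocks_cons d (step d i) (steps (step d i) E).
    rewrite /block_step /= (eqxx d) /= => <- /=.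
    by congr pair; case: p; case: (odd _).
  by rewrite /block_step /= (eqxx d) /= => <- /=; rewrite !andbF.
have := IHE e (step e i) true.
have [v [bs ->]] := blocks_cons e (step e i) (steps (step e i) E).
by rewrite /block_step /= (eq_sym d) ed /= => <- /=; rewrite !andbF.
Qed.

Lemma decreasing_take i E k : (k <= size E)%N ->
  decreasing (take k.+1 (i :: steps i E)) = (k <= find id E)%N.
Proof.
rewrite /decreasing /=; elim: E i k => [|e E IHE] i [|k] //= leks.
by rewrite IHE // (step_eq e false); case: e.
Qed.

Lemma size_longest_decreasing_prefix i E :
  size (longest_decreasing_prefix (i :: steps i E)) = (find id E).+1.
Proof.
have szE : size (i :: steps i E) = (size E).+1 by rewrite /= size_scanl.
have leF := find_size id E.
rewrite /longest_decreasing_prefix; set k := (\max_(_ < _ | _) _)%N.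
suff -> : k = (find id E).+1.
  by rewrite size_take szE ltnS; case: ltngtP leF => // ->.
apply/eqP; rewrite eqn_leq; apply/andP; split.
  apply/bigmax_leqP => -[[|m] /= ltm] //.
  rewrite -/(take m.+1 (i :: _)) => decm.
  by rewrite ltnS -(@decreasing_take i E m) //; rewrite size_scanl in ltm.
have ltF : ((find id E).+1 < (size (i :: steps i E)).+1)%N by rewrite szE.
by apply: (leq_bigmax_cond (Ordinal ltF)); rewrite decreasing_take.
Qed.

Definition starts_decreasing (w : word) : bool :=
  ~~ odd (size (longest_decreasing_prefix w)) &&
  (0 < size (drop (size (longest_decreasing_prefix w)) w))%N.

Lemma starts_decreasing_steps i E :
  starts_decreasing (i :: steps i E) = odd (find id E) && has id E.
Proof.
rewrite /starts_decreasing size_longest_decreasing_prefix oddS negbK size_drop.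
by rewrite subn_gt0 [size (i :: _)]/= size_scanl ltnS -has_find.
Qed.

Lemma words_to_coordinatesE i (w : word) :
  words_to_coordinates (i :: w) =
    let sd := starts_decreasing (i :: w) in
    let bs := blocks (~~ sd) (i :: w) in
    let u := (\sum_(b <- bs | b.1) size b.2)%N in
    let b := last (true, [::]) bs in
    let x : int := if b.1 && odd (size b.2) then u.+1 else u in
    coordinates_of (if sd then i - 1 else i)%R x (Posz (size (i :: w)) - x).
Proof. by []. Qed.

Lemma words_to_coordinates_steps i d E :
  odd (find id E) && has id E = ~~ d ->
  let b := foldl block_step (d, true) E in
  let x : int := (d + count id E + (b.1 && b.2))%N in
  words_to_coordinates (i :: steps i E) =
  coordinates_of (if d then i else i - 1)%R x ((size E).+1%:Z - x)%R.
Proof.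
move=> dE b x; rewrite words_to_coordinatesE starts_decreasing_steps dE.
cbv zeta; rewrite negbK count_blocks [size (i :: _)]/= size_scanl if_neg.
have [-> ->] : (last (true, [::]) (blocks d (i :: steps i E))).1 = b.1 /\
       odd (size (last (true, [::]) (blocks d (i :: steps i E))).2) = b.2.
  by rewrite /b -(last_blocks d i E).
by congr (coordinates_of _ _ (_ - _)); rewrite /x; case: (_ && _); lia.
Qed.

(** Before the first increasing direction there are only complete pairs --. *)
Lemma paired_find E : paired E -> has id E -> ~~ odd (find id E).
Proof.
by elim/paired_ind => {E} [|[]|[] E _ IHE] //= hasE; rewrite negbK IHE.
Qed.

(** From an even length, a pair restores an even length, whether it extends the block or opens a new
    one. *)
Lemma block_step_even t E : paired E ->
  foldl block_step (t, false) E = (last t E, odd (size E)).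
Proof.
move=> pE; elim/paired_ind: pE t => {E} [//|d|d E _ IHE] t /=.
  by rewrite /block_step orbT.
by rewrite /block_step /= orbT eqxx /= IHE negbK.
Qed.

(** Pairs ++ keep the length of the first block odd; the first decreasing direction opens a new
    block, and from there pairs leave even lengths. *)
Lemma block_step_inc E : paired E -> ~~ all id E ->
  foldl block_step (true, true) E = (last true E, odd (size E)).
Proof.
elim/paired_ind => {E} [//|[]//|[] E pE IHE] /= nE.
  by rewrite {2 3}/block_step /= IHE // negbK.
by rewrite {2 3}/block_step /= block_step_even // negbK.
Qed.

(* The first letter is paired with the second one, d being the direction to it *)
(* from a virtual letter p; this is the case of an even x.                     *)
Lemma words_to_coordinates_even p d E : paired (d :: E) ->
  odd (find id E) && has id E = ~~ d ->
  words_to_coordinates (steps p (d :: E)) =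
  (let x : int := (count id (d :: E) + dangling (d :: E))%N in
   coordinates_of (p + 1) x ((size E).+1%:Z - x))%R.
Proof.
move=> pE dE; rewrite [steps _ _]/= (words_to_coordinates_steps _ dE).
have -> : (if d then step d p else step d p - 1)%R = (p + 1)%R.
  by case: (d); rewrite /step; case: (Z3_cases p) => ->; apply: val_inj.
have -> : (foldl block_step (d, true) E).1 && (foldl block_step (d, true) E).2
   = dangling (d :: E).
  case: E pE {dE} => [|e E] /=; first by rewrite /dangling /= andbT.
  case/andP=> /eqP <- pE; rewrite {2 4}/block_step /= eqxx block_step_even //.
  by rewrite /dangling /= negbK andbC; case: E {pE}.
by [].
Qed.

(** The first letter counts alone as increasing and the pairs begin after it, so x is odd. *)
Lemma words_to_coordinates_odd i E : paired E -> ~~ all id E ->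
  words_to_coordinates (i :: steps i E) =
  (let x : int := (1 + count id E + dangling E)%N in
   coordinates_of i x ((size E).+1%:Z - x))%R.
Proof.
move=> pE nE; have dE : odd (find id E) && has id E = ~~ true.
  by case hE: (has id E); rewrite ?andbF // (negbTE (paired_find pE hE)).
rewrite (words_to_coordinates_steps _ dE) block_step_inc //=.
by rewrite /dangling andbC; case: E nE {pE dE}.
Qed.

(** * Correctness for words with paired directions *)

Lemma alcove_at_words_even p d E : paired (d :: E) ->
  odd (find id E) && has id E = ~~ d ->
  alcove_at (words_to_coordinates (steps p (d :: E))) = elt (steps p (d :: E)).
Proof.
move=> pE dE; rewrite words_to_coordinates_even //.
have := alcove_at_steps pE (p + 1)%R 0%R (y := 0%R) isT.
have -> : (p + 1 - 1 + 0%:~R - 0%:~R = p)%R by rewrite /=; ring.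
have -> : alcove_at (coordinates_of (p + 1) 0 0) = 1.
  have -> : coordinates_of (p + 1) 0 0 = (0, 0)%R.
    by rewrite /coordinates_of; case: (Z3_cases p) => ->.
  by rewrite /alcove_at /alcove elt_nil mulg1.
by rewrite mul1g => ->; congr (alcove_at (coordinates_of _ _ _)); lia.
Qed.

Lemma alcove_at_words_odd i E : paired E -> ~~ all id E ->
  alcove_at (words_to_coordinates (i :: steps i E)) = elt (i :: steps i E).
Proof.
move=> pE nE; rewrite words_to_coordinates_odd //.
have := alcove_at_steps pE i 1%R (y := 0%R) isT.
have -> : (i - 1 + 1%:~R - 0%:~R = i)%R by rewrite /=; ring.
(* At (1, -1) the formula gives the identity, and the crossing to (1, 0) reads the letter [i]. *)
have -> : alcove_at (coordinates_of i 1 0) = gen i.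
  have := coordinates_of_dec i 1 (-1).
  have -> : coordinates_of i 1 (-1) = (0, 0)%R.
    by rewrite /coordinates_of; case: (Z3_cases i) => ->.
  rewrite /alcove_at /alcove elt_nil !mul1g => <-; congr gen.
  by rewrite intrN; ring.
by rewrite -elt_cons => ->; congr (alcove_at (coordinates_of _ _ _)); lia.
Qed.

(** * Directions of a reduced word *)

Definition geodesic (w : word) : Prop :=
  forall v : word, elt v = elt w -> (size w <= size v)%N.

Lemma reduced_geodesic w : reduced w -> geodesic w.
Proof.
move=> wred v vw; rewrite wred /W_length; case: ex_minnP => n _; apply.
by apply/asboolP; exists v.
Qed.

Lemma geodesic_infix u w v : geodesic (u ++ w ++ v) -> geodesic w.
Proof.
move=> geo w' w'w; have := geo (u ++ w' ++ v).
by rewrite !eltM w'w !size_cat => /(_ erefl); lia.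
Qed.

Lemma geodesic_steps_cat i E1 E2 :
  geodesic (i :: steps i (E1 ++ E2)) -> geodesic (i :: steps i E1).
Proof. by rewrite scanl_cat -cat_cons => /(@geodesic_infix [::]). Qed.

Lemma geodesic_cons_neq i j w : geodesic [:: i, j & w] -> j != i.
Proof.
move=> geo; apply/eqP => ji; have := geo w.
by rewrite ji !elt_cons mulgA genK mul1g /= => /(_ erefl); lia.
Qed.

(* The braid relation turns a final +,+,- into -,-,+ (and conversely), which   *)
(* shortens the middle run by two; the runs +,-,+ and -,+,- are not reduced.   *)
Lemma shorten_odd_run f k (i : 'Z_3) : exists v : word,
  elt v = elt (i :: steps i (~~ f :: nseq k.*2.+1 f ++ [:: ~~ f])) /\
  size v = k.*2.+2.
Proof.
elim: k => [|k [v [vE szv]]].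
  (* With a = [i] and b = [step (~~ f) i], the word is abab = babb = ba. *)
  exists [:: step (~~ f) i; i]; split=> //=.
  have -> : step f (step (~~ f) i) = i by rewrite -{1}(negbK f) stepK.
  rewrite !elt_cons elt_nil !mulg1 !mulgA gen_braid.
  by rewrite -mulgA genK mulg1.
pose E := ~~ f :: nseq k.*2.+1 f; pose q := foldl (fun i d => step d i) i E.
exists (v ++ [:: step f q; step (~~ f) q]).
split; last by rewrite size_cat szv doubleS /= addn2.
have -> : i :: steps i (~~ f :: nseq k.+1.*2.+1 f ++ [:: ~~ f]) =
    (i :: steps i E) ++ [:: step f q; step (~~ f) q; step f q].
  have -> : k.+1.*2.+1 = (k.*2.+1 + 2)%N by lia.
  by rewrite nseqD -catA -cat_cons scanl_cat -/q /= stepK (step2 f q).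
have -> : elt (v ++ [:: step f q; step (~~ f) q]) =
    elt ((i :: steps i E) ++ [:: step (~~ f) q; step f q; step (~~ f) q]).
  rewrite eltM vE -eltM -cat_cons scanl_cat -/q.
  by rewrite -cat_cons -catA.
rewrite !eltM; congr (_ * _); rewrite !elt_cons elt_nil !mulg1 !mulgA.
by rewrite -(step2 f q) gen_braid.
Qed.

(** The leading run of [f] in a paired [E] has even length unless it is all of [E], in which case
    [f :: E] would be paired. *)
Lemma unpaired_odd_run f E : paired E -> ~~ paired (f :: E) ->
  exists k E', E = nseq k.*2 f ++ ~~ f :: E'.
Proof.
elim/paired_ind => {E} [//|d|d E _ IHE] /=; rewrite ?andbT.
  by move=> fd; exists 0, [::]; case: f d fd => [] [].
case: eqVneq => [<-|fd] /=; last first.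
  by move=> _; exists 0, (d :: E); case: f d fd {IHE} => [] [].
by move=> /IHE[k [E' ->]]; exists k.+1, E'; rewrite doubleS.
Qed.

(** When a new first letter breaks both pairings, an odd run of [f] lies between two opposite
    directions, and [shorten_odd_run] contradicts minimality. *)
Lemma geodesic_paired i (w : word) : geodesic (i :: w) ->
  exists2 E, w = steps i E & paired E || paired (behead E).
Proof.
elim: w i => [|j w IHw] i geo; first by exists [::].
have [e jE] := Z3_neq_step (geodesic_cons_neq geo).
have geo_jw : geodesic (j :: w).
  by apply: (@geodesic_infix [:: i] _ [::]); rewrite cats0.
have [E wE pE] := IHw j geo_jw.
exists (e :: E); first by rewrite /= -jE wE.
have [pE' | nE] := boolP (paired E); first by apply/orP; right.
case: E nE pE wE => [//|f E] nE; rewrite (negbTE nE) /= => pE wE.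
case: eqVneq => [_ | ef]; first by rewrite pE.
have [k [E' EE]] := unpaired_odd_run pE nE.
have {}ef : e = ~~ f by case: e f ef {jE nE wE EE} => [] [].
have [v [vE szv]] := shorten_odd_run f k i; case/negP: (ltnn (size v)).
have geo' : geodesic (i :: steps i (~~ f :: nseq k.*2.+1 f ++ [:: ~~ f])).
  apply: (@geodesic_steps_cat _ _ E').
  by move: geo; rewrite wE jE EE ef /= -catA.
have := geo' _ vE; rewrite szv /= size_scanl size_cat size_nseq /=; lia.
Qed.

(** * Choosing the pairing used by the algorithm *)

Lemma alcove_at_reduced (w : word) :
  reduced w -> alcove_at (words_to_coordinates w) = elt w.
Proof.
move=> /reduced_geodesic; case: w => [|i w] geo.
  by rewrite /alcove_at /alcove !mulg1.
have [E -> pE] := geodesic_paired geo => {geo w}.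
(* The virtual letter is the one from which direction [d] leads to [i]. *)
have even_case d : paired (d :: E) -> odd (find id E) && has id E = ~~ d ->
    alcove_at (words_to_coordinates (i :: steps i E)) = elt (i :: steps i E).
  move=> pdE dE; have := alcove_at_words_even (step (~~ d) i) pdE dE.
  suff -> : steps (step (~~ d) i) (d :: E) = i :: steps i E by [].
  by rewrite /= -{1 3}(negbK d) stepK.
(* A single increasing block gives an even x, so the virtual direction is used here although [E] is
   paired too. *)
have [/all_pred1P EE | nE] := boolP (all (pred1 true) E).
  apply: (even_case true); rewrite EE.
    exact: (paired_nseq true (size E).+1).
  by case: (size E).
have {}nE : ~~ all id E by rewrite -(eq_all (a1 := pred1 true)) // => -[].
have [pE' | npE] := boolP (paired E); first exact: alcove_at_words_odd.
case: E nE npE pE even_case => // d E nE npE pE even_case.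
have {}pE : paired E by move: pE; rewrite (negbTE npE).
apply: (even_case d); first by rewrite /= eqxx.
case: d {nE even_case} npE => //= npE.
(* For a decreasing [d], an increasing direction must follow, since a constant sequence would be
   paired. *)
have [hE | nE] := boolP (has id E); first by rewrite (paired_find pE hE).
case/negP: npE; suff -> : E = nseq (size E) false.
  exact: (paired_nseq false (size E).+1).
apply/all_pred1P; move: nE; rewrite -all_predC.
by rewrite (@eq_all _ _ (pred1 false)) // => -[].
Qed.

Theorem theorem1p1 (g : W) (w : word) (hw : reduced w) (hg : elt w = g) :
  even_coordinates g (words_to_coordinates w).
Proof.
split; last by rewrite -hg; exact: alcove_at_reduced.
by case: w {hw hg} => // i w; rewrite words_to_coordinatesE coordinates_of_even.
Qed.
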